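(* Let $p,q$ be relatively prime integers with $0<p<q$, with continued fraction expansion $q/p=[a_1,\dots,a_n]$, and let $(p_k,q_k)$ $(-1\le k\le n)$ be the associated convergents. Put $D_k:=pq_k-qp_k$. Let $e,f$ be positive integers such that $N=e+f$ is even. Then $$s_{e,f}(p,q)+\delta(e,f)B_eB_f=\frac{1}{q^{N-2}}s^I_{e,f}(p,q)+\frac{1}{q^{N-1}}s^R_{e,f}(p,q),$$ where $$s_{e,f}^I(p,q)=e!\,f!\sum_{\alpha+\beta=e-1}\left[\sum_{k=-1}^{n-1}(-1)^{k+1}f_k(\alpha,\beta)+\frac{B_N}{N!}\sum_{k=0}^{n-1}(-1)^k a_{k+1}\,g_k(\alpha,\beta)\right],$$ $$s_{e,f}^R(p,q)=e!\,f!\,\frac{B_N}{N!}\left[\binom{N-1}{f}p^{f}+(-1)^{e(n-1)}\binom{N-1}{e}(q_{n-1})^{e}\right],$$ the outer sum being over integers $\alpha,\beta\ge 0$, and $$f_k(\alpha,\beta)=\frac{q_k^{\beta}q_{k+1}^{\alpha}}{\alpha!\,\beta!}\sum_{i=\alpha}^{N-2-\beta}\frac{(-1)^i}{(N-2-i-\beta)!\,(i-\alpha)!}\,\frac{B_{i+1}}{i+1}\,\frac{B_{N-i-1}}{N-i-1}\,D_k^{N-2-i-\beta}D_{k+1}^{i-\alpha},$$ $$g_k(\alpha,\beta)=\frac{q_{k-1}^{\beta}q_{k+1}^{\alpha}}{\alpha!\,\beta!}\sum_{i=\alpha}^{N-2-\beta}\frac{(N-i-2)!}{(N-2-i-\b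eta)!}\,\frac{i!}{(i-\alpha)!}\,D_{k-1}^{N-i-2-\beta}D_{k+1}^{i-\alpha}.$$
   Context: $B_m$ is the $m$-th Bernoulli number ($\frac{t}{e^t-1}=\sum_m B_m t^m/m!$). $\bar B_m$ is the $m$-th periodic Bernoulli function: $\bar B_m(x)=B_m(x-\lfloor x\rfloor)$ with $B_m(\cdot)$ the Bernoulli polynomial, except that $\bar B_1(x)=0$ for $x\in\mathbb Z$ (so $\bar B_1$ is the sawtooth function $((x))$). The generalized Dedekind sum is $$s_{i,j}(p,q):=\sum_{k=0}^{q-1}\bar B_i\!\left(\frac kq\right)\bar B_j\!\left(\frac{pk}{q}\right).$$ $\delta(i,j)=1$ if $i=1$ or $j=1$, and $\delta(i,j)=0$ otherwise. Continued fraction: $q/p=a_1+\cfrac{1}{a_2+\cdots+\cfrac{1}{a_n}}$ with all $a_i\ge 1$ integers. Convergents: $(p_{-1},q_{-1})=(1,0)$, $(p_0,q_0)=(0,1)$, and $(p_{k+1},q_{k+1})=(p_{k-1},q_{k-1})+a_{k+1}(p_k,q_k)$ for $0\le k\le n-1$; thus $(p_n,q_n)=(p,q)$, and $q_k/p_k=[a_1,\dots,a_k]$ for $1\le k\le n$. Convention $0^0=1$. *)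

(* Defs.v *)
From HB Require Import structures.
From mathcomp Require Import all_boot all_order all_algebra.
Set Implicit Arguments.
Unset Strict Implicit.
Unset Printing Implicit Defensive.
Import Order.TTheory GRing.Theory Num.Theory.
Local Open Scope ring_scope.

(* A formal power series is its sequence of coefficients.  [series_inv c] is
   its reciprocal, provided c 0 != 0 (see [series_invP]). *)
Fixpoint series_inv_seq (F : fieldType) (c : nat -> F) (n : nat) : seq F :=
  if n is m.+1 then
    let s := series_inv_seq c m in
    rcons s (((m == 0%N)%:R - \sum_(k < m) s`_k * c (m - k)%N) / c 0%N)
  else [::].

Definition series_inv (F : fieldType) (c : nat -> F) (n : nat) : F :=
  (series_inv_seq c n.+1)`_n.

Lemma size_series_inv_seq (F : fieldType) (c : nat -> F) n :
  size (series_inv_seq c n) = n.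
Proof. by elim: n => //= n IHn; rewrite size_rcons IHn. Qed.

Lemma nth_series_inv_seq (F : fieldType) (c : nat -> F) n k :
  (k < n)%N -> (series_inv_seq c n)`_k = series_inv c k.
Proof.
elim: n => // n IHn; rewrite ltnS leq_eqVlt => /orP[/eqP -> //|lt_kn].
by rewrite /= nth_rcons size_series_inv_seq lt_kn IHn.
Qed.

Lemma series_invP (F : fieldType) (c : nat -> F) : c 0%N != 0 ->
  forall n, \sum_(k < n.+1) series_inv c k * c (n - k)%N = (n == 0%N)%:R.
Proof.
move=> c0 n.
have eq_s : \sum_(k < n) (series_inv_seq c n)`_k * c (n - k)%N =
            \sum_(k < n) series_inv c k * c (n - k)%N.
  by apply: eq_bigr => k _; rewrite nth_series_inv_seq.
rewrite big_ord_recr /= subnn [series_inv c n]/series_inv /=.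
by rewrite nth_rcons size_series_inv_seq ltnn eqxx divfK // eq_s addrC subrK.
Qed.

(* B_m / m! is the coefficient of t^m in t / (e^t - 1), the reciprocal of
   (e^t - 1) / t = \sum_k t^k / (k+1)!; in particular B_1 = -1/2. *)
Definition bernoulli (F : fieldType) (m : nat) : F :=
  m`!%:R * series_inv (fun k => (k.+1`!%:R)^-1) m.

(* (\sum_m B_m t^m / m!) * (e^t - 1) = t, coefficient by coefficient. *)
Lemma bernoulli_genfun (R : numFieldType) (n : nat) :
  \sum_(k < n.+1) bernoulli R k / k`!%:R *
    (if (n - k == 0)%N then 0 else ((n - k)`!%:R)^-1) = (n == 1%N)%:R.
Proof.
case: n => [|n]; first by rewrite big_ord1 /= mulr0.
have fact_neq0 k : k`!%:R != 0 :> R by rewrite pnatr_eq0 -lt0n fact_gt0.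
rewrite big_ord_recr /= subnn mulr0 addr0 eqSS.
rewrite -(@series_invP R (fun k => (k.+1`!%:R)^-1)) ?invr_eq0 //.
apply: eq_bigr => k _; have lekn : (k <= n)%N by rewrite -ltnS.
rewrite subSn //=; congr (_ * _).
by rewrite /bernoulli mulrAC divff // mul1r.
Qed.

Definition bernoulli_poly (F : fieldType) (m : nat) : {poly F} :=
  \sum_(k < m.+1) ('C(m, k)%:R * bernoulli F (m - k)) *: 'X^k.

Definition periodic_bernoulli (R : archiRealFieldType) (m : nat) (x : R) : R :=
  if (m == 1%N) && (x \is a Num.int) then 0
  else (bernoulli_poly R m).[x - (Num.floor x)%:~R].

Definition dedekind_sum (R : archiRealFieldType) (i j p q : nat) : R :=
  \sum_(0 <= k < q) periodic_bernoulli i (k%:R / q%:R : R) *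
                    periodic_bernoulli j ((p * k)%:R / q%:R : R).

Definition delta1 (i j : nat) : nat := ((i == 1) || (j == 1))%N.

(* [a_1, ..., a_n]; the value 0 on the empty list is junk. *)
Fixpoint cfrac (F : fieldType) (a : seq nat) : F :=
  match a with
  | [::] => 0
  | [:: x] => x%:R
  | x :: s => x%:R + (cfrac F s)^-1
  end.

(* Indices are shifted by one, since the convergents start at -1:
   [convergent a j] is (p_(j-1), q_(j-1)).  As lists are indexed from 0, the
   partial quotient a_(k+1) is [nth 0 a k]. *)
Fixpoint convergent (a : seq nat) (j : nat) : nat * nat :=
  match j with
  | 0 => (1, 0)
  | 1 => (0, 1)
  | (k.+1 as j').+1 =>
      let u := convergent a k in
      let v := convergent a j' in
      (u.1 + nth 0 a k * v.1, u.2 + nth 0 a k * v.2)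
  end%N.

Definition cvg_p (a : seq nat) (j : nat) : nat := (convergent a j).1.
Definition cvg_q (a : seq nat) (j : nat) : nat := (convergent a j).2.

(* [cvg_D R a p q j] is D_(j-1). *)
Definition cvg_D (R : pzRingType) (a : seq nat) (p q j : nat) : R :=
  p%:R * (cvg_q a j)%:R - q%:R * (cvg_p a j)%:R.

(* [f_term R a p q N j al be] is f_(j-1)(al, be). *)
Definition f_term (R : fieldType) (a : seq nat) (p q N j al be : nat) : R :=
  ((cvg_q a j)%:R ^+ be * (cvg_q a j.+1)%:R ^+ al) / (al`!%:R * be`!%:R) *
  \sum_(al <= i < (N - 2 - be).+1)
    (-1) ^+ i / ((N - 2 - i - be)`!%:R * (i - al)`!%:R) *
    (bernoulli R i.+1 / i.+1%:R) *
    (bernoulli R (N - i - 1) / (N - i - 1)%:R) *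
    cvg_D R a p q j ^+ (N - 2 - i - be) * cvg_D R a p q j.+1 ^+ (i - al).

(* [g_term R a p q N k al be] is g_k(al, be), which involves q_(k-1), q_(k+1),
   D_(k-1) and D_(k+1), at the shifted indices k and k + 2. *)
Definition g_term (R : fieldType) (a : seq nat) (p q N k al be : nat) : R :=
  ((cvg_q a k)%:R ^+ be * (cvg_q a k.+2)%:R ^+ al) / (al`!%:R * be`!%:R) *
  \sum_(al <= i < (N - 2 - be).+1)
    ((N - i - 2)`!%:R / (N - 2 - i - be)`!%:R) * (i`!%:R / (i - al)`!%:R) *
    cvg_D R a p q k ^+ (N - i - 2 - be) * cvg_D R a p q k.+2 ^+ (i - al).

(* In the sum of the f_k, j = k + 1 runs from 0 to n = size a. *)
Definition sI (R : fieldType) (a : seq nat) (e f p q : nat) : R :=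
  let N := (e + f)%N in
  e`!%:R * f`!%:R *
  \sum_(al < e) \sum_(be < e | (al + be == e - 1)%N)
    (\sum_(0 <= j < (size a).+1) (-1) ^+ j * f_term R a p q N j al be +
     bernoulli R N / N`!%:R *
     \sum_(0 <= k < size a)
        (-1) ^+ k * (nth 0%N a k)%:R * g_term R a p q N k al be).

(* With n = size a, q_(n-1) is [cvg_q a n]. *)
Definition sR (R : fieldType) (a : seq nat) (e f p : nat) : R :=
  let N := (e + f)%N in
  let n := size a in
  e`!%:R * f`!%:R * (bernoulli R N / N`!%:R) *
  ('C(N - 1, f)%:R * p%:R ^+ f +
   (-1) ^+ (e * (n - 1)) * 'C(N - 1, e)%:R * (cvg_q a n)%:R ^+ e).

(* Main.v *)
Require Import Defs.
From mathcomp Require Import all_boot all_order all_algebra.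
From mathcomp Require Import zify ring.
Set Implicit Arguments.
Unset Strict Implicit.
Unset Printing Implicit Defensive.
Import Order.TTheory GRing.Theory Num.Theory.
Local Open Scope ring_scope.

(** Put N = e + f.  For k = -1, ..., n let A_k = D_k + q_k y, a polynomial in
    y; these satisfy A_(k+1) = A_(k-1) + a_(k+1) A_k, with A_(-1) = - q,
    A_0 = p + y and A_n = q y.  The s_(i,j)(p, q) + delta(i, j) B_i B_j with
    i + j = N and i, j >= 1 are, up to normalization, the coefficients of the
    y^(i-1) in the part of degree N - 2 in t of
      G = \sum_(k < q) e^(k y t) e^((p k mod q) t)
                       / ((e^(q y t) - 1) (e^(q t) - 1)),
    because e^(x t) / (e^t - 1) generates the Bernoulli polynomials
    ([dedekind_sumE], [coef_inv_expm1_exp]).  Since k y + (p k mod q) =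
    k A_0 + floor (p k / q) A_(-1), the numerator of G is
      C (u, v; q, p) = \sum_(k < q) u^k v^(floor (p k / q))
    at u = e^(A_0 t) and v = e^(A_(-1) t).

    Carlitz reciprocity ([carlitz_reciprocity]) relates C (u, v; q, p) to
    C (v, u; p, q), and division of q by p turns the latter into
    C (v u^a, u; p, q mod p), where v u^a = e^(A_1 t).  Iterating along the
    Euclidean algorithm telescopes ([cf_telescope]) to
      - G = \sum_(k = -1)^(n-1) (-1)^(k+1)
                / ((e^(A_k t) - 1) (e^(A_(k+1) t) - 1))
            + [n even] / (e^(q y t) - 1).
    In degree N - 2 ([cf_identity_coef]) the products of two regular parts of
    the 1 / (e^(A t) - 1) give the f_k.  The products of a pole 1 / A_k with
    the terms B_N / N! A_(k-1)^(N-1) and B_N / N! A_(k+1)^(N-1) of its two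
    neighbours combine into a_(k+1) g_k ([telescope_poles]), except for the
    poles at both ends, which give s^R.  Multiplied by y, the resulting identity
    between values at all but finitely many y is one between polynomials
    ([cf_identity_poly]), and the theorem is its coefficient of y^e.

    As N is even, Bernoulli numbers of odd index contribute only if N = 2;
    there the sign (-1)^i of the f_k is accounted for by the summand with
    [n even] ([sum_sign_mixed_parity]). *)

(** * Carlitz reciprocity *)

(** The points of a rectangle strictly on either side of its diagonal; none
    lies on the diagonal since p + 1 and q + 1 are coprime. *)
Lemma rectangle_diagonal_split (K : comNzRingType) (u v : K) (p q : nat) :
    coprime p.+1 q.+1 ->
  \sum_(k < q) \sum_(j < p) u ^+ k * v ^+ j =
  \sum_(k < q) u ^+ k * (\sum_(j < (p.+1 * k.+1) %/ q.+1) v ^+ j) +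
  \sum_(j < p) v ^+ j * (\sum_(k < (q.+1 * j.+1) %/ p.+1) u ^+ k).
Proof.
move=> cpq.
have floor_le m n k : (k < n)%N -> ((m.+1 * k.+1) %/ n.+1 <= m)%N.
  by move=> lt_kn; rewrite -ltnS ltn_divLR //; nia.
pose below k j := (j < (p.+1 * k.+1) %/ q.+1)%N.
have belowN k j : (k < q)%N -> ~~ below k j = (k < (q.+1 * j.+1) %/ p.+1)%N.
  move=> lt_kq; rewrite /below !leq_divRL // -ltnNge.
  rewrite [RHS]leq_eqVlt [(k.+1 * _)%N]mulnC [(j.+1 * _)%N]mulnC.
  case: eqP => //= eq_kj.
  have : (q.+1 %| p.+1 * k.+1)%N by rewrite eq_kj dvdn_mulr.
  rewrite Gauss_dvdr; last by rewrite coprime_sym.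
  by move/(dvdn_leq (ltn0Sn k)); lia.
transitivity (\sum_(k < q) (\sum_(j < p | below k j) u ^+ k * v ^+ j
              + \sum_(j < p | ~~ below k j) u ^+ k * v ^+ j)).
  by apply: eq_bigr => k _; rewrite (bigID (fun j : 'I_p => below k j)).
rewrite big_split /=; congr (_ + _).
  apply: eq_bigr => k _; rewrite mulr_sumr.
  by rewrite (big_ord_widen p (fun j => u ^+ k * v ^+ j)) // floor_le.
under eq_bigr => k _ do rewrite big_mkcond.
rewrite exchange_big /=; apply: eq_bigr => j _.
rewrite (big_ord_widen q (fun j => u ^+ j)) ?floor_le // mulr_sumr.
rewrite [RHS]big_mkcond.
by apply: eq_bigr => k _; rewrite belowN // mulrC.
Qed.

(** The Carlitz polynomial C (u, v; q, p). *)
Definition floor_sum (K : comNzRingType) (u v : K) (q p : nat) : K :=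
  \sum_(k < q) u ^+ k * v ^+ ((p * k) %/ q).

Lemma carlitz_reciprocity (K : comNzRingType) (u v : K) (p q : nat) :
    (0 < p)%N -> (0 < q)%N -> coprime p q ->
  v * (u - 1) * floor_sum u v q p + u * (v - 1) * floor_sum v u p q =
  u ^+ q * v ^+ p + u * v - u - v.
Proof.
case: p => // p _; case: q => // q _ cpq; rewrite /floor_sum.
rewrite !big_ord_recl /= !muln0 !div0n !expr0.
have E1 : (u - 1) * \sum_(k < q) u ^+ k * v ^+ ((p.+1 * k.+1) %/ q.+1) =
          (u - 1) * (v - 1) * (\sum_(k < q) u ^+ k *
             (\sum_(j < (p.+1 * k.+1) %/ q.+1) v ^+ j)) + (u ^+ q - 1).
  rewrite (subrX1 u q) -mulrA -mulrDr; congr (_ * _).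
  rewrite mulr_sumr -big_split; apply: eq_bigr => k _ /=.
  by rewrite mulrCA -subrX1 mulrBr mulr1 subrK.
have E2 : (v - 1) * \sum_(k < p) v ^+ k * u ^+ ((q.+1 * k.+1) %/ p.+1) =
          (u - 1) * (v - 1) * (\sum_(k < p) v ^+ k *
             (\sum_(j < (q.+1 * k.+1) %/ p.+1) u ^+ j)) + (v ^+ p - 1).
  rewrite (subrX1 v p) [(u - 1) * _]mulrC -mulrA -mulrDr; congr (_ * _).
  rewrite mulr_sumr -big_split; apply: eq_bigr => k _ /=.
  by rewrite mulrCA -subrX1 mulrBr mulr1 subrK.
have E3 : (u - 1) * (v - 1) * \sum_(k < q) \sum_(j < p) u ^+ k * v ^+ j =
          (u ^+ q - 1) * (v ^+ p - 1).
  rewrite (subrX1 u q) (subrX1 v p) mulrACA; congr (_ * _).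
  by rewrite mulr_suml; apply: eq_bigr => k _; rewrite mulr_sumr.
have F1 : \sum_(i < q) u ^+ bump 0 i * v ^+ (p.+1 * bump 0 i %/ q.+1) =
          u * \sum_(k < q) u ^+ k * v ^+ ((p.+1 * k.+1) %/ q.+1).
  by rewrite mulr_sumr; apply: eq_bigr => k _; rewrite exprS mulrA.
have F2 : \sum_(i < p) v ^+ bump 0 i * u ^+ (q.+1 * bump 0 i %/ p.+1) =
          v * \sum_(k < p) v ^+ k * u ^+ ((q.+1 * k.+1) %/ p.+1).
  by rewrite mulr_sumr; apply: eq_bigr => k _; rewrite exprS mulrA.
rewrite {}F1 {}F2; move: E3; rewrite rectangle_diagonal_split // mulrDr => E3.
move: E1 E2 E3.
set X := \sum_(k < q) _; set Y := \sum_(k < p) _.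
set Z := \sum_(k < q) _; set W := \sum_(k < p) _ => E1 E2 E3.
rewrite !exprS.
transitivity (v * (u - 1) + u * (v - 1)
              + u * v * (((u - 1) * X) + (v - 1) * Y)).
  by ring.
rewrite E1 E2.
transitivity (v * (u - 1) + u * (v - 1) + u * v * (((u - 1) * (v - 1) * Z
   + (u - 1) * (v - 1) * W) + (u ^+ q - 1 + (v ^+ p - 1)))); first by ring.
by rewrite E3; ring.
Qed.

(** * Telescoping along the continued fraction *)

(** [(q, p)] with [q / p = [a_1, ..., a_n]] in lowest terms; [(1, 0)] on the
    empty list. *)
Fixpoint cf_pair (a : seq nat) : nat * nat :=
  if a is x :: s then
    let r := cf_pair s in (x * r.1 + r.2, r.1)%N
  else (1, 0)%N.

Lemma cf_pair_gt0 (a : seq nat) : all (leq 1) a -> (0 < (cf_pair a).1)%N.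
Proof. by elim: a => //= x s IHs /andP[x0 /IHs]; nia. Qed.

Lemma cf_pair_coprime (a : seq nat) : coprime (cf_pair a).1 (cf_pair a).2.
Proof. by elim: a => //= x s IHs; rewrite /coprime gcdnC gcdnMDl. Qed.

Lemma cf_pair_ratio (F : numFieldType) (a : seq nat) :
  all (leq 1) a -> a != [::] ->
  cfrac F a = (cf_pair a).1%:R / (cf_pair a).2%:R.
Proof.
elim: a => // x [|y s] IHs; first by rewrite /= muln1 addn0 divr1.
move=> /andP[_ a_ge1] _; rewrite -[LHS]/(x%:R + (cfrac F (y :: s))^-1).
rewrite IHs // invf_div.
have := @cf_pair_gt0 (y :: s) a_ge1; have -> : cf_pair [:: x, y & s] =
    (x * (cf_pair (y :: s)).1 + (cf_pair (y :: s)).2, (cf_pair (y :: s)).1)%N.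
  by [].
move: (cf_pair (y :: s)) => r r_gt0 /=; rewrite natrD natrM mulrDl mulfK //.
by rewrite pnatr_eq0 -lt0n.
Qed.

Lemma cf_pair_unique (F : numFieldType) (a : seq nat) (p q : nat) :
    coprime p q -> (0 < p)%N -> (0 < q)%N -> all (leq 1) a ->
    q%:R / p%:R = cfrac F a ->
  a != [::] /\ cf_pair a = (q, p).
Proof.
move=> cpq p_gt0 q_gt0 a_ge1 hcf.
have p_neq0 : p%:R != 0 :> F by rewrite pnatr_eq0 -lt0n.
have a_neq0 : a != [::].
  apply/eqP => a0; move: hcf; rewrite a0 /= => /eqP.
  by rewrite mulf_eq0 invr_eq0 (negPf p_neq0) orbF pnatr_eq0 eqn0Ngt q_gt0.
split=> //; have r2_gt0 : (0 < (cf_pair a).2)%N.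
  by case: a a_neq0 a_ge1 {hcf} => //= x s _ /andP[_ /cf_pair_gt0].
have r2_neq0 : (cf_pair a).2%:R != 0 :> F by rewrite pnatr_eq0 -lt0n.
move/eqP: hcf; rewrite cf_pair_ratio // eqr_div // -!natrM eqr_nat => /eqP.
have := cf_pair_coprime a.
case: (cf_pair a) r2_gt0 {r2_neq0} => r s /= s_gt0 crs E.
have Eps : p = s.
  apply/eqP; rewrite eqn_dvd; apply/andP; split.
    by rewrite -(@Gauss_dvdr p q) // E dvdn_mull.
  by rewrite -(@Gauss_dvdr s r) 1?coprime_sym // -E dvdn_mull.
by move/eqP: E; rewrite Eps eqn_pmul2r // => /eqP ->.
Qed.

(** Here [u j] stands for e^(A_(j-1) t), [l j] for t / (e^(A_(j-1) t) - 1),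
    [w] for e^(A_n t), [lw] for t / (e^(A_n t) - 1) and [tau] for t.
    The factor [tau] is kept on both sides because it need not be regular in
    [K]. *)
Lemma cf_telescope (K : comNzRingType) (tau w lw : K) (a : seq nat)
    (u l : nat -> K) :
    all (leq 1) a ->
    (forall k, (k < size a)%N -> u k.+2 = u k * u k.+1 ^+ nth 0%N a k) ->
    (forall j, (j < (size a).+2)%N -> l j * (u j - 1) = tau) ->
    lw * (w - 1) = tau ->
    w = u 1%N ^+ (cf_pair a).1 * u 0%N ^+ (cf_pair a).2 ->
  tau * (u 0%N * floor_sum (u 1%N) (u 0%N) (cf_pair a).1 (cf_pair a).2
         * l 0%N * lw) =
  tau * (\sum_(j < (size a).+1) (-1) ^+ j * (l j * l j.+1)) +
  tau ^+ 2 * ((~~ odd (size a))%:R * lw).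
Proof.
move=> + + + Hlw; elim: a u l => [|x s IHs] u l /=.
  move=> _ _ Hl; rewrite expr1 expr0 mulr1 => Ew.
  rewrite /floor_sum !big_ord1 /= muln0 div0n !expr0 !mul1r !mulr1.
  have E0 := Hl 0%N isT; have E1 := Hl 1%N isT.
  have Elw : tau * lw = tau * l 1%N.
    by rewrite -{1}E1 -Hlw Ew mulrAC [in RHS]mulrAC [_ * lw]mulrC.
  transitivity ((l 0%N * (u 0%N - 1) + l 0%N) * (tau * lw)); first by ring.
  by rewrite E0 [in RHS]mulrA expr2 -!mulrA Elw; ring.
move=> /andP[x_gt0 s_ge1] Hu Hl Ew.
have r_gt0 := cf_pair_gt0 s_ge1.
have u2 : u 2%N = u 0%N * u 1%N ^+ x by apply: (Hu 0%N).
have {}IHs := IHs (u \o S) (l \o S) s_ge1 (fun k => Hu k.+1)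
                (fun j => Hl j.+1).
have {IHs} /IHs/= IH : w = (u \o S) 1%N ^+ (cf_pair s).1
                          * (u \o S) 0%N ^+ (cf_pair s).2.
  by rewrite /= u2 Ew exprMn -exprM exprD; ring.
have E0 := Hl 0%N isT; have E1 := Hl 1%N isT.
move: r_gt0 Ew IH (cf_pair_coprime s).
case: (cf_pair s) => p r /= p_gt0 Ew IH cpr.
have cpq : coprime p (x * p + r) by rewrite /coprime gcdnMDl.
have q_gt0 : (0 < x * p + r)%N by nia.
(* floor (q k / p) = x k + floor (r k / p), and u_2 = u_0 u_1^x. *)
have Efl : floor_sum (u 2%N) (u 1%N) p r =
    floor_sum (u 0%N) (u 1%N) p (x * p + r).
  apply: eq_bigr => k _; rewrite u2 exprMn -exprM -mulrA -exprD.
  by rewrite mulnDl -mulnA [(p * k)%N]mulnC mulnA divnMDl.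
have R := carlitz_reciprocity (u 1%N) (u 0%N) p_gt0 q_gt0 cpq.
rewrite {}Efl in IH; rewrite -Ew in R.
rewrite big_ord_recl /=.
set C := floor_sum (u 1%N) _ _ _ in R *.
set C' := floor_sum (u 0%N) _ _ _ in R IH.
set Sg := \sum_(i < _) _ in IH.
have -> : \sum_(i < (size s).+1)
    (-1) ^+ bump 0 i * (l (bump 0 i) * l (bump 0 i).+1) = - Sg.
  by rewrite -sumrN; apply: eq_bigr => i _; rewrite exprS mulN1r mulNr.
have key : tau * (u 0%N * C * l 0%N * lw) + tau * (u 1%N * C' * l 1%N * lw) =
           tau * (l 0%N * l 1%N) + tau ^+ 2 * lw.
  (* Carlitz reciprocity times l_0 l_1 l_w; its right-hand side is
     (w - 1) + (u_0 - 1) (u_1 - 1). *)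
  transitivity (l 0%N * l 1%N * lw *
    (u 0%N * (u 1%N - 1) * C + u 1%N * (u 0%N - 1) * C')).
    by rewrite -{1}E1 -E0; ring.
  by rewrite R expr2 -{1}Hlw -{1}E1 -E0; ring.
have -> : (~~ ~~ odd (size s))%:R = 1 - (~~ odd (size s))%:R :> K.
  by case: (odd _); rewrite /= ?subr0 ?subrr.
rewrite expr0 mul1r.
by rewrite (canRL (addrK _) key) IH; ring.
Qed.

(** * Truncated exponential series *)

Lemma bernoulli0 (R : numFieldType) : bernoulli R 0 = 1.
Proof.
have := @series_invP R (fun k => (k.+1`!%:R)^-1) _ 0.
by rewrite big_ord1 invr1 mulr1 oner_eq0 /bernoulli mul1r; apply.
Qed.

Section TruncatedSeries.
Variables (R : numFieldType) (M : nat).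

(* Power series in t truncated after t^M, as classes modulo 'X^(M+1). *)
Local Notation trunc := (in_qpoly ('X^(M.+1) : {poly R})).

Lemma truncP (P Q : {poly R}) :
  trunc P = trunc Q <-> forall i, (i <= M)%N -> P`_i = Q`_i.
Proof.
have coef_trunc (P' : {poly R}) i :
    (trunc P' : {poly R})`_i = if (i < M.+1)%N then P'`_i else 0.
  by rewrite /= mk_monic_Xn -Pdiv.RingMonic.take_poly_rmodp coef_take_poly.
split=> [eqPQ i le_iM|eqPQ].
  by have := coef_trunc P i; rewrite eqPQ coef_trunc ltnS le_iM => <-.
apply/val_inj/polyP => i; rewrite /= -/(val (trunc P)) -/(val (trunc Q)).
rewrite -[LHS]/((trunc P : {poly R})`_i) -[RHS]/((trunc Q : {poly R})`_i).
rewrite !coef_trunc; case: ltnP => // le_iM; exact: eqPQ.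
Qed.

(** The series e^(c t), truncated. *)
Definition exp_series (c : R) : {poly R} := \poly_(k < M.+1) (c ^+ k / k`!%:R).

(** The series t / (e^(c t) - 1), truncated; meaningful for c != 0. *)
Definition inv_expm1_series (c : R) : {poly R} :=
  \poly_(k < M.+1) (bernoulli R k / k`!%:R * c ^+ k / c).

Lemma fact_neq0 k : k`!%:R != 0 :> R.
Proof. by rewrite pnatr_eq0 -lt0n fact_gt0. Qed.

Lemma bin_factV i j : (j <= i)%N ->
  'C(i, j)%:R / i`!%:R = (j`!%:R)^-1 / (i - j)`!%:R :> R.
Proof.
move=> le_ji; rewrite -(bin_fact le_ji) !natrM.
have : 'C(i, j)%:R != 0 :> R by rewrite pnatr_eq0 -lt0n bin_gt0.
have := fact_neq0 j; have := fact_neq0 (i - j).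
by move=> *; field; apply/and3P.
Qed.

Lemma trunc_exp0 : trunc (exp_series 0) = 1.
Proof.
rewrite -(rmorph1 trunc); apply/truncP => i le_iM.
rewrite coef_poly ltnS le_iM coef1 expr0n.
by case: i {le_iM} => [|i]; rewrite ?divr1 ?mul0r.
Qed.

Lemma trunc_expD c d :
  trunc (exp_series (c + d)) = trunc (exp_series c) * trunc (exp_series d).
Proof.
rewrite -rmorphM; apply/truncP => i le_iM.
rewrite coef_poly ltnS le_iM coefM addrC exprDn mulr_suml.
apply: eq_bigr => j _; have le_ji : (j <= i)%N by rewrite -ltnS.
rewrite !coef_poly !ltnS (leq_trans le_ji le_iM).
rewrite (leq_trans (leq_subr j i) le_iM) -mulr_natl.
by rewrite mulrAC bin_factV //; ring.
Qed.

Lemma trunc_exp_natmul c n :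
  trunc (exp_series c) ^+ n = trunc (exp_series (n%:R * c)).
Proof.
elim: n => [|n IHn]; first by rewrite mul0r trunc_exp0.
by rewrite [LHS]exprS IHn -trunc_expD -[n.+1]add1n natrD mulrDl mul1r.
Qed.

Lemma trunc_inv_expm1 c : c != 0 ->
  trunc (inv_expm1_series c) * (trunc (exp_series c) - 1) = trunc 'X.
Proof.
move=> c_neq0; rewrite -(rmorph1 trunc) -rmorphB -rmorphM.
apply/truncP => i le_iM; rewrite coefM coefX -(bernoulli_genfun R i).
transitivity (c ^+ i / c * \sum_(k < i.+1) bernoulli R k / k`!%:R *
    (if (i - k == 0)%N then 0 else ((i - k)`!%:R)^-1)).
  rewrite mulr_sumr; apply: eq_bigr => k _.
  have le_ki : (k <= i)%N by rewrite -ltnS.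
  rewrite coefB !coef_poly coef1 !ltnS (leq_trans le_ki le_iM).
  rewrite (leq_trans (leq_subr k i) le_iM).
  have -> : c ^+ i = c ^+ k * c ^+ (i - k) by rewrite -exprD subnKC.
  case: eqP => [->|_]; last by rewrite subr0; ring.
  by rewrite expr0 divr1 subrr !mulr0.
rewrite bernoulli_genfun; case: eqP => [->|_]; last by rewrite mulr0.
by rewrite expr1 divff ?mulr1.
Qed.

(** Coefficients of t e^(r t) / (e^(c t) - 1). *)
Lemma coef_inv_expm1_exp c r i : c != 0 -> (i <= M)%N ->
  (inv_expm1_series c * exp_series r)`_i =
  c ^+ i / c * ((bernoulli_poly R i).[r / c] / i`!%:R).
Proof.
move=> c_neq0 le_iM; rewrite coefMr /bernoulli_poly horner_sum.
rewrite mulr_suml mulr_sumr.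
apply: eq_bigr => j _; have le_ji : (j <= i)%N by rewrite -ltnS.
rewrite hornerZ hornerXn !coef_poly !ltnS (leq_trans le_ji le_iM).
rewrite (leq_trans (leq_subr j i) le_iM).
transitivity (c ^+ i / c *
  ('C(i, j)%:R / i`!%:R * bernoulli R (i - j) * (r / c) ^+ j)).
  rewrite bin_factV // expr_div_n.
  have -> : c ^+ i = c ^+ (i - j) * c ^+ j by rewrite -exprD subnK.
  have := expf_neq0 j c_neq0; have := fact_neq0 j; have := fact_neq0 (i - j).
  by move=> *; field; apply/and4P.
by congr (_ * _); ring.
Qed.

(** e^(- c t) / (e^(- c t) - 1) = - 1 / (e^(c t) - 1), times t^2. *)
Lemma trunc_inv_expm1N c : c != 0 ->
  trunc 'X * (trunc (inv_expm1_series (- c)) * trunc (exp_series (- c))) =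
  - (trunc 'X * trunc (inv_expm1_series c)).
Proof.
move=> c_neq0; have EL := trunc_inv_expm1 c_neq0.
have := trunc_inv_expm1 (c := - c); rewrite oppr_eq0 => /(_ c_neq0) ELN.
have := trunc_expD c (- c); rewrite subrr trunc_exp0 => EE.
move: EL ELN EE.
set e := trunc (exp_series c); set e' := trunc (exp_series (- c)).
set l := trunc (inv_expm1_series c); set l' := trunc (inv_expm1_series (- c)).
set t := trunc 'X; clearbody e e' l l' t => EL ELN EE.
rewrite -{1}EL -ELN.
transitivity (l * l' * (e * e' - e')); first by ring.
by rewrite -EE; ring.
Qed.

End TruncatedSeries.

(** * The telescoped identity in a fixed degree *)

Lemma polyC_sign (K : comNzRingType) (j : nat) :
  ((-1) ^+ j)%:P = (-1) ^+ j :> {poly K}.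
Proof. by rewrite rmorphXn /= rmorphN1. Qed.

Section ContinuedFractionIdentity.
(* [A j] is A_(j-1), evaluated at y. *)
Variables (R : numFieldType) (a : seq nat) (A : nat -> R) (y : R).
Hypothesis a_ge1 : all (leq 1) a.
Let q := (cf_pair a).1.
Let p := (cf_pair a).2.
Let n := size a.
Hypothesis A0E : A 0%N = - q%:R.
Hypothesis A1E : A 1%N = p%:R + y.
Hypothesis A_rec :
  forall k, (k < n)%N -> A k.+2 = A k + (nth 0%N a k)%:R * A k.+1.
Hypothesis A_neq0 : forall j, (j < n.+2)%N -> A j != 0.
Hypothesis y_neq0 : y != 0.

Let q_gt0 : (0 < q)%N := cf_pair_gt0 a_ge1.
Let q_neq0 : q%:R != 0 :> R.
Proof. by rewrite pnatr_eq0 -lt0n. Qed.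

Local Notation tr M := (in_qpoly ('X^(M.+1) : {poly R})).

Lemma trunc_cf_identity M :
  tr M ('X *
    - \sum_(k < q)
      (inv_expm1_series M (q%:R * y) * exp_series M (k%:R * y)) *
      (inv_expm1_series M q%:R * exp_series M ((p * k) %% q)%:R)) =
  tr M ('X *
    (\sum_(j < n.+1) (-1) ^+ j *
        (inv_expm1_series M (A j) * inv_expm1_series M (A j.+1)) +
     'X * ((~~ odd n)%:R * inv_expm1_series M (q%:R * y)))).
Proof.
pose u j := tr M (exp_series M (A j)).
pose l j := tr M (inv_expm1_series M (A j)).
pose w := tr M (exp_series M (q%:R * y)).
pose lw := tr M (inv_expm1_series M (q%:R * y)).
have qy_neq0 : q%:R * y != 0 by rewrite mulf_neq0.
have Hu k : (k < n)%N -> u k.+2 = u k * u k.+1 ^+ nth 0%N a k.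
  by move=> lt_kn; rewrite /u trunc_exp_natmul -trunc_expD A_rec.
have Hl j : (j < n.+2)%N -> l j * (u j - 1) = tr M 'X.
  by move=> lt_jn; apply: trunc_inv_expm1; apply: A_neq0.
have Hw : w = u 1%N ^+ q * u 0%N ^+ p.
  rewrite /u !trunc_exp_natmul -trunc_expD A0E A1E.
  by congr (tr M (exp_series M _)); ring.
have := cf_telescope a_ge1 Hu Hl (trunc_inv_expm1 M qy_neq0) Hw.
rewrite -/q -/p -/n -/lw => E.
rewrite !rmorphM rmorphN rmorphD rmorphM /= mulrDr.
rewrite [tr M 'X * (tr M 'X * _)]mulrA -expr2.
have -> : tr M (\sum_(j < n.+1) (-1) ^+ j *
      (inv_expm1_series M (A j) * inv_expm1_series M (A j.+1))) =
    \sum_(j < n.+1) (-1) ^+ j * (l j * l j.+1).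
  rewrite rmorph_sum; apply: eq_bigr => j _.
  by rewrite !rmorphM /= rmorphXn /= rmorphN1.
rewrite rmorphM rmorph_nat /= -/lw -E.
have -> : floor_sum (u 1%N) (u 0%N) q p =
    \sum_(k < q) tr M (exp_series M (k%:R * y)) *
                 tr M (exp_series M ((p * k) %% q)%:R).
  (* k A_0 + floor (p k / q) A_(-1) = k y + (p k mod q) *)
  apply: eq_bigr => k _; rewrite /u !trunc_exp_natmul -!trunc_expD A0E A1E.
  congr (tr M (exp_series M _)).
  have /(congr1 (fun m => m%:R : R)) := divn_eq (p * k) q.
  rewrite natrD !natrM => Ek; rewrite mulrDr [k%:R * p%:R]mulrC Ek; ring.
have /(congr1 (fun x => - x)) := trunc_inv_expm1N M q_neq0; rewrite opprK.
rewrite -A0E -/(u 0%N) -/(l 0%N) => E0.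
rewrite rmorph_sum /=.
transitivity (- (tr M 'X * tr M (inv_expm1_series M q%:R)) * lw *
  \sum_(k < q) tr M (exp_series M (k%:R * y)) *
               tr M (exp_series M ((p * k) %% q)%:R)).
  rewrite !mulNr mulrN; congr (- _); rewrite -!mulrA; congr (_ * _).
  rewrite mulr_sumr mulr_sumr; apply: eq_bigr => k _.
  rewrite !rmorphM /= /lw; ring.
rewrite -E0 opprK; ring.
Qed.

(** The coefficient of t^(N-2) in the telescoped identity, written with
    B_m / m! A^m / A for the coefficient of t^(m-1) in 1 / (e^(A t) - 1); the
    poles are the terms with m = 0 or m = N. *)
Lemma cf_identity_coef N : (0 < N)%N ->
  - \sum_(k < q) \sum_(i < N.+1)
     ((q%:R * y) ^+ i / (q%:R * y) *
       ((bernoulli_poly R i).[k%:R / q%:R] / i`!%:R)) *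
     (q%:R ^+ (N - i) / q%:R *
       ((bernoulli_poly R (N - i)).[((p * k) %% q)%:R / q%:R] / (N - i)`!%:R)) =
  \sum_(j < n.+1) (-1) ^+ j * (\sum_(m < N.+1)
     (bernoulli R m / m`!%:R * A j ^+ m / A j) *
     (bernoulli R (N - m) / (N - m)`!%:R * A j.+1 ^+ (N - m) / A j.+1)) +
  (~~ odd n)%:R *
    (bernoulli R N.-1 / N.-1`!%:R * (q%:R * y) ^+ N.-1 / (q%:R * y)).
Proof.
move=> N_gt0; have qy_neq0 : q%:R * y != 0 by rewrite mulf_neq0.
(* The common factor 'X shifts degree N to N + 1. *)
have := trunc_cf_identity N.+1; rewrite truncP => /(_ N.+1 (leqnn _)).
rewrite !coefXM /= coefN coefD coefXM !coef_sum (gtn_eqF N_gt0).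
have le_N i : (i <= N -> i <= N.+1)%N by move=> /leqW.
rewrite [(~~ odd n)%:R * inv_expm1_series _ _]mulr_natl coefMn.
rewrite -[_ *+ (~~ odd n)]mulr_natl coef_poly.
rewrite ltnS le_N ?leq_pred // => E.
etransitivity; last first.
  etransitivity; first exact: E.
  congr (_ + _); apply: eq_bigr => j _.
  rewrite -polyC_sign coefCM coefM; congr (_ * _); apply: eq_bigr => m _.
  have le_mN : (m <= N)%N by rewrite -ltnS.
  by rewrite !coef_poly !ltnS !le_N ?leq_subr.
congr (- _); apply: eq_bigr => k _; rewrite coefM; apply: eq_bigr => i _.
have le_iN : (i <= N)%N by rewrite -ltnS.
rewrite !coef_inv_expm1_exp ?le_N ?leq_subr //.
by rewrite -mulf_div divff // mulr1.
Qed.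

End ContinuedFractionIdentity.

(** * Cancellation of the poles *)

(** The form \sum_i c_i x^(N-2-i) z^i of degree N - 2; for c = 1 it is
    (x^(N-1) - z^(N-1)) / (x - z). *)
Definition mixed_sum (K : comNzRingType) (c : nat -> K) (N : nat) (x z : K) :=
  \sum_(i < N.-1) c i * (x ^+ (N - 2 - i) * z ^+ i).

(** The two terms with the inner pole 1 / A_(k+1) combine because
    A_(k+2) - A_k = c_k A_(k+1). *)
Lemma telescope_poles (F : fieldType) (c A : nat -> F) (n N : nat) :
    (1 < N)%N ->
    (forall k, (k < n)%N -> A k.+2 = A k + c k * A k.+1) ->
    (forall j, (j < n.+2)%N -> A j != 0) ->
  \sum_(j < n.+1) (-1) ^+ j * (A j.+1 ^+ N.-1 / A j + A j ^+ N.-1 / A j.+1) =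
  A 1%N ^+ N.-1 / A 0%N + (-1) ^+ n * (A n ^+ N.-1 / A n.+1) -
  \sum_(k < n) (-1) ^+ k * c k * mixed_sum (fun _ => 1) N (A k) (A k.+2).
Proof.
case: N => [|[|M]] // _; elim: n => [|n IHn] A_rec A_neq0.
  by rewrite big_ord1 big_ord0 expr0 !mul1r subr0.
rewrite big_ord_recr [in RHS]big_ord_recr /= IHn; first last.
- by move=> j lt_j; apply: A_neq0; apply: leqW.
- by move=> j lt_j; apply: A_rec; apply: leqW.
have E : c n * mixed_sum (fun _ => 1) M.+2 (A n) (A n.+2) =
         (A n.+2 ^+ M.+1 - A n ^+ M.+1) / A n.+1.
  have -> : A n.+2 ^+ M.+1 - A n ^+ M.+1 =
      (A n.+2 - A n) * mixed_sum (fun _ => 1) M.+2 (A n) (A n.+2).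
    rewrite -[LHS]opprB subrXX -mulNr opprB; congr (_ * _).
    by apply: eq_bigr => i _; rewrite mul1r /= !subSS subn0.
  rewrite A_rec // [A n + _]addrC addrK mulrAC mulfK //.
  exact: A_neq0 (leqW (ltnSn _)).
rewrite -[(-1) ^+ n * c n * _]mulrA E !exprS; ring.
Qed.

Lemma split_poles (F : fieldType) (b c A : nat -> F) (n N : nat) :
    (1 < N)%N -> b 0%N = 1 ->
    (forall k, (k < n)%N -> A k.+2 = A k + c k * A k.+1) ->
    (forall j, (j < n.+2)%N -> A j != 0) ->
  \sum_(j < n.+1) (-1) ^+ j * (\sum_(m < N.+1)
     (b m * A j ^+ m / A j) * (b (N - m)%N * A j.+1 ^+ (N - m) / A j.+1)) =
  \sum_(j < n.+1) (-1) ^+ j *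
     mixed_sum (fun i => b i.+1 * b (N - i - 1)%N) N (A j) (A j.+1) +
  b N * (A 1%N ^+ N.-1 / A 0%N + (-1) ^+ n * (A n ^+ N.-1 / A n.+1) -
     \sum_(k < n) (-1) ^+ k * c k * mixed_sum (fun _ => 1) N (A k) (A k.+2)).
Proof.
move=> N_gt1 b0 A_rec A_neq0; rewrite -telescope_poles // mulr_sumr -big_split.
apply: eq_bigr => j _; rewrite /= [b N * _]mulrCA -mulrDr; congr (_ * _).
have /A_neq0 Aj : (j < n.+2)%N by apply: leqW.
have /A_neq0 Aj1 : (j.+1 < n.+2)%N by rewrite ltnS.
case: N N_gt1 => [|[|M]] // _.
rewrite big_ord_recl big_ord_recr /= /bump /= add1n subn0 subnn b0 !expr0.
rewrite /mixed_sum /= [X in _ + (X + _) = _](_ : _ =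
  \sum_(i < M.+1) b i.+1 * b (M.+2 - i - 1)%N *
     (A j ^+ (M.+2 - 2 - i) * A j.+1 ^+ i)).
  by rewrite !exprS; field; rewrite ?Aj ?Aj1.
(* The sum over m counts powers of A_j, [mixed_sum] those of A_(j+1). *)
rewrite (reindex_inj rev_ord_inj); apply: eq_bigr => i _ /=.
have le_iM : (i <= M)%N by rewrite -ltnS.
have -> : (1 + (M.+1 - i.+1) = (M - i).+1)%N by rewrite subSS.
have -> : (M.+2 - (M - i).+1 = i.+1)%N by lia.
have -> : (M.+2 - i - 1 = (M - i).+1)%N by lia.
have -> : (M.+2 - 2 - i = M - i)%N by lia.
by rewrite !exprS; field; rewrite ?Aj ?Aj1.
Qed.

(** * Convergents *)

Lemma cf_pair_invariant (K : comNzRingType) (a : seq nat) (A : nat -> K) :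
    (forall k, (k < size a)%N -> A k.+2 = A k + (nth 0%N a k)%:R * A k.+1) ->
  A (size a).+1 = (cf_pair a).1%:R * A 1%N + (cf_pair a).2%:R * A 0%N.
Proof.
elim: a A => [|x s IHs] A A_rec /=; first by rewrite mul1r mul0r addr0.
rewrite (IHs (fun j => A j.+1) (fun k => A_rec k.+1)) (A_rec 0%N) //=.
by rewrite natrD natrM; ring.
Qed.

Lemma convergentSS (a : seq nat) (k : nat) :
  (cvg_p a k.+2 = cvg_p a k + nth 0 a k * cvg_p a k.+1)%N /\
  (cvg_q a k.+2 = cvg_q a k + nth 0 a k * cvg_q a k.+1)%N.
Proof. by []. Qed.

Lemma cvg_q_last (a : seq nat) : cvg_q a (size a).+1 = (cf_pair a).1.
Proof.
apply/eqP; rewrite -eqz_nat; apply/eqP.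
rewrite -[Posz _]/((cvg_q a (size a).+1)%:Z) -!natz.
rewrite (cf_pair_invariant (A := fun j => (cvg_q a j)%:R)).
  by rewrite mulr0 addr0 mulr1.
by move=> k _; rewrite (convergentSS a k).2 natrD natrM.
Qed.

Lemma cvg_p_last (a : seq nat) : cvg_p a (size a).+1 = (cf_pair a).2.
Proof.
apply/eqP; rewrite -eqz_nat; apply/eqP; rewrite -!natz.
rewrite (cf_pair_invariant (A := fun j => (cvg_p a j)%:R)).
  by rewrite mulr0 add0r mulr1.
by move=> k _; rewrite (convergentSS a k).1 natrD natrM.
Qed.

Lemma convergent_det (K : comNzRingType) (a : seq nat) (j : nat) :
  (cvg_p a j)%:R * (cvg_q a j.+1)%:R - (cvg_p a j.+1)%:R * (cvg_q a j)%:R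
  = (-1) ^+ j :> K.
Proof.
elim: j => [|j IHj]; first by rewrite mul1r mul0r subr0.
rewrite !(convergentSS a j).1 !(convergentSS a j).2 !natrD !natrM exprS -IHj.
by ring.
Qed.

Lemma cvg_q_gt0 (a : seq nat) (j : nat) :
  all (leq 1) a -> (j <= size a)%N -> (0 < cvg_q a j.+1)%N.
Proof.
move=> a_ge1; elim: j => [|j IHj] // lt_j.
rewrite (convergentSS a j).2 addn_gt0 muln_gt0 IHj ?(ltnW lt_j) // andbT.
by rewrite (all_nthP 0%N a_ge1) // orbT.
Qed.

(** * The polynomial identity *)

Lemma poly_eq_off_zeros (F : numFieldType) (W P Q : {poly F}) :
  W != 0 -> (forall y, W.[y] != 0 -> P.[y] = Q.[y]) -> P = Q.
Proof.
move=> W_neq0 eqPQ; apply/eqP; rewrite -subr_eq0; apply/eqP.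
set Z := P - Q; have: W * Z = 0.
  apply/eqP; apply: contraT => WZ_neq0.
  pose s := [seq i%:R : F | i <- iota 0 (size (W * Z))].
  have uniq_s : uniq s.
    by rewrite map_inj_uniq ?iota_uniq // => i j /eqP; rewrite eqr_nat => /eqP.
  have root_s : all (root (W * Z)) s.
    apply/allP => y _; rewrite rootE hornerM.
    have [->|/eqPQ E] := eqVneq W.[y] 0; first by rewrite mul0r.
    by rewrite /Z hornerD hornerN E subrr mulr0.
  have := max_poly_roots WZ_neq0 root_s uniq_s.
  by rewrite size_map size_iota ltnn.
by move/eqP; rewrite mulf_eq0 (negPf W_neq0) => /eqP.
Qed.

Lemma horner_mixed_sum (F : fieldType) (c : nat -> {poly F}) (N : nat)
    (P Q : {poly F}) (y : F) :
  (mixed_sum c N P Q).[y] = mixed_sum (fun i => (c i).[y]) N P.[y] Q.[y].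
Proof.
by rewrite horner_sum; apply: eq_bigr => i _; rewrite !hornerM !horner_exp.
Qed.

(** The polynomial A_(j-1) = D_(j-1) + q_(j-1) y. *)
Definition cvg_poly (R : comNzRingType) (a : seq nat) (p q j : nat) :
  {poly R} :=
  (cvg_D R a p q j)%:P + (cvg_q a j)%:R *: 'X.

Lemma horner_cvg_poly (R : comNzRingType) (a : seq nat) (p q j : nat) (y : R) :
  (cvg_poly R a p q j).[y] = cvg_D R a p q j + (cvg_q a j)%:R * y.
Proof. by rewrite hornerD hornerC hornerZ hornerX. Qed.

(** [cf_identity_coef] times y, with the poles split off by [split_poles].
    The last summand comes from [n even] / (e^(q y t) - 1). *)
Lemma cf_identity_poly (R : numFieldType) (a : seq nat) (N : nat) :
    all (leq 1) a -> (1 < N)%N ->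
  let q := (cf_pair a).1 in let p := (cf_pair a).2 in let n := size a in
  let A := cvg_poly R a p q in let b m : R := bernoulli R m / m`!%:R in
  - \sum_(k < q) \sum_(i < N.+1)
     (q%:R ^+ (N - 2) * ((bernoulli_poly R i).[k%:R / q%:R] / i`!%:R) *
      ((bernoulli_poly R (N - i)).[((p * k) %% q)%:R / q%:R] / (N - i)`!%:R))
     *: 'X^i =
  'X * (\sum_(j < n.+1) (-1) ^+ j *
          mixed_sum (fun i => (b i.+1 * b (N - i - 1)%N)%:P) N (A j) (A j.+1)
        - (b N)%:P * \sum_(k < n) (-1) ^+ k * (nth 0%N a k)%:R *
          mixed_sum (fun _ => 1) N (A k) (A k.+2))
  + (b N / q%:R) *: ((-1) ^+ n * A n ^+ N.-1 - 'X * A 1%N ^+ N.-1)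
  + ((~~ odd n)%:R * b N.-1 * q%:R ^+ (N - 2)) *: 'X^(N.-1).
Proof.
move=> a_ge1 N_gt1 q p n A b.
have q_neq0 : q%:R != 0 :> R by rewrite pnatr_eq0 -lt0n cf_pair_gt0.
have A0E y : (A 0%N).[y] = - q%:R.
  by rewrite horner_cvg_poly /cvg_D mulr0 mulr1 mul0r addr0 sub0r.
have coef1_A i : (A i)`_1 = (cvg_q a i)%:R.
  by rewrite coefD coefC coefZ coefX add0r mulr1.
have A_poly_neq0 j : (j < n.+2)%N -> A j != 0.
  case: j => [|j] lt_j; apply/eqP => Aj0.
    move: (A0E 0); rewrite Aj0 horner0 => /eqP.
    by rewrite eq_sym oppr_eq0 (negPf q_neq0).
  have := coef1_A j.+1; rewrite Aj0 coef0 => /eqP.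
  by rewrite eq_sym pnatr_eq0 eqn0Ngt cvg_q_gt0.
apply: (@poly_eq_off_zeros _ ('X * \prod_(j < n.+2) A j)).
  rewrite mulf_neq0 ?polyX_eq0 //; apply/prodf_neq0 => j _.
  exact: A_poly_neq0.
move=> y; rewrite hornerM hornerX horner_prod mulf_eq0 negb_or.
case/andP=> y_neq0 /prodf_neq0 prod_neq0.
pose v j := (A j).[y].
have v_neq0 j : (j < n.+2)%N -> v j != 0.
  by move=> lt_j; apply: (prod_neq0 (Ordinal lt_j)).
have v1 : v 1%N = p%:R + y.
  by rewrite /v horner_cvg_poly /cvg_D mulr1 mulr0 subr0 mul1r.
have v_rec k : (k < n)%N -> v k.+2 = v k + (nth 0%N a k)%:R * v k.+1.
  move=> _; rewrite /v !horner_cvg_poly /cvg_D.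
  by rewrite (convergentSS a k).1 (convergentSS a k).2 !natrD !natrM; ring.
have v_last : v n.+1 = q%:R * y.
  by rewrite /v horner_cvg_poly /cvg_D cvg_q_last cvg_p_last mulrC subrr add0r.
have := cf_identity_coef a_ge1 (A0E y) v1 v_rec v_neq0 y_neq0 (ltnW N_gt1).
rewrite -/p -/q -/n => /(congr1 ( *%R y)).
rewrite (@split_poles _ b (fun k => (nth 0%N a k)%:R)) //; last first.
  by rewrite /b bernoulli0 divr1.
have v0 := A0E y; rewrite -/(v 0%N) in v0.
rewrite v0 v_last => E.
clearbody A; rewrite !(hornerD, hornerN, hornerM, hornerZ, hornerX, hornerXn,
  horner_exp, hornerC).
rewrite -[(A n).[y]]/(v n) -[(A 1%N).[y]]/(v 1%N).
rewrite !horner_sum.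
have -> : \sum_(j < n.+1) ((-1) ^+ j *
      mixed_sum (fun i => (b i.+1 * b (N - i - 1)%N)%:P) N (A j) (A j.+1)).[y] =
    \sum_(j < n.+1) (-1) ^+ j *
      mixed_sum (fun i => b i.+1 * b (N - i - 1)%N) N (v j) (v j.+1).
  apply: eq_bigr => j _.
  rewrite hornerM horner_mixed_sum horner_exp hornerN hornerC.
  by congr (_ * _); apply: eq_bigr => i _; rewrite hornerC.
have -> : \sum_(k < n) ((-1) ^+ k * (nth 0%N a k)%:R *
      mixed_sum (fun _ => 1) N (A k) (A k.+2)).[y] =
    \sum_(k < n) (-1) ^+ k * (nth 0%N a k)%:R *
      mixed_sum (fun _ => 1) N (v k) (v k.+2).
  apply: eq_bigr => k _.
  rewrite !hornerM horner_mixed_sum horner_exp hornerN hornerC hornerMn hornerC.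
  by congr (_ * _); apply: eq_bigr => i _; rewrite hornerC.
have qy_neq0 : q%:R * y != 0 by rewrite mulf_neq0.
case: N N_gt1 E => [|[|M]] // _ E.
set S1 := \sum_(j < n.+1) _ in E *; set S2 := \sum_(k < n) _ in E *.
transitivity (y * (S1 + b M.+2 * (v 1%N ^+ M.+1 / - q%:R
     + (-1) ^+ n * (v n ^+ M.+1 / (q%:R * y)) - S2)
     + (~~ odd n)%:R * (b M.+1 * (q%:R * y) ^+ M.+1 / (q%:R * y)))); last first.
  rewrite /= !subSS subn0 [(q%:R * y) ^+ _]exprS [y ^+ M.+1]exprS exprMn.
  by field; rewrite q_neq0 y_neq0.
rewrite -[RHS]E mulrN mulr_sumr; congr (- _); apply: eq_bigr => k _.
rewrite horner_sum mulr_sumr; apply: eq_bigr => i _.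
rewrite hornerZ hornerXn; have le_iM : (i <= M.+2)%N by rewrite -ltnS.
have -> : q%:R ^+ (M.+2 - 2) = q%:R ^+ i * q%:R ^+ (M.+2 - i) / q%:R ^+ 2 :> R.
  by rewrite -exprD subnKC // -[M.+2]addn2 addnK exprD mulfK ?expf_neq0.
rewrite exprMn; move: (_.[_] / _) (_.[_] / _) => B1 B2.
by field; rewrite q_neq0 y_neq0.
Qed.

(** * Bernoulli numbers of odd index *)

Lemma bernoulli1 (R : numFieldType) : bernoulli R 1 = - 2^-1.
Proof.
have := bernoulli_genfun R 2; rewrite !big_ord_recl big_ord0 /= bernoulli0.
rewrite !divr1 mul1r mulr0 !addr0.
by rewrite addrC => /eqP; rewrite addr_eq0 => /eqP.
Qed.

(** t / (e^(-t) - 1) + t = - t / (e^t - 1), compared in degree m. *)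
Lemma bernoulli_odd (R : numFieldType) (m : nat) :
  odd m -> (1 < m)%N -> bernoulli R m = 0.
Proof.
move=> odd_m m_gt1; have N1_neq0 : -1 != 0 :> R by rewrite oppr_eq0 oner_eq0.
have l1 := trunc_inv_expm1N m.+1 (oner_neq0 R).
have e1 := trunc_inv_expm1 m.+1 N1_neq0.
pose tr := in_qpoly ('X^(m.+2) : {poly R}).
have : tr ('X * (inv_expm1_series m.+1 (-1) + 'X)) =
       tr ('X * - inv_expm1_series m.+1 1).
  rewrite /tr !rmorphM rmorphD rmorphN /= mulrN -l1 -[X in _ + X]e1; ring.
rewrite truncP => /(_ m.+1 (leqnn _)); rewrite !coefXM /= coefD coefN coefX.
rewrite gtn_eqF // addr0 !coef_poly leqW // -signr_odd odd_m expr1.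
rewrite expr1n mulr1 invrN1 mulrN1 mulrN opprK mulr1 divr1 => /eqP.
by rewrite eq_sym eqNr mulf_eq0 invr_eq0 (negPf (fact_neq0 _ _)) orbF => /eqP.
Qed.

(** Inserting the signs (-1)^i.  If N > 2, a product b_(i+1) b_(N-i-1) with i
    even vanishes, as does b_(N-1); if N = 2, the only product is
    b_1 b_1 = 1 / 4, and the alternating sum over j is 1 for n even and 0
    for n odd. *)
Lemma sum_sign_mixed_parity (R : numFieldType) (N n q : nat)
    (A : nat -> {poly R}) :
    (1 < N)%N -> ~~ odd N ->
  let b m : R := bernoulli R m / m`!%:R in
  \sum_(j < n.+1) (-1) ^+ j *
    mixed_sum (fun i => (b i.+1 * b (N - i - 1)%N)%:P) N (A j) (A j.+1) +
  ((~~ odd n)%:R * b N.-1 * q%:R ^+ (N - 2)) *: 'X^(N - 2) =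
  - \sum_(j < n.+1) (-1) ^+ j *
    mixed_sum (fun i => ((-1) ^+ i * b i.+1 * b (N - i - 1)%N)%:P) N
      (A j) (A j.+1).
Proof.
move=> N_gt1 even_N b.
have b1 : b 1%N = - 2^-1 by rewrite /b bernoulli1 divr1.
have b_odd m : odd m -> (1 < m)%N -> b m = 0.
  by move=> odd_m m_gt1; rewrite /b bernoulli_odd // mul0r.
have [N_gt2|N_le2] := ltnP 2 N.
  have oddN1 : odd N.-1 by case: (N) N_gt1 even_N => // M _ /=; rewrite negbK.
  rewrite (b_odd N.-1) //; last by lia.
  rewrite mulr0 mul0r scale0r addr0 -sumrN; apply: eq_bigr => j _.
  rewrite -mulrN; congr (_ * _); rewrite -sumrN; apply: eq_bigr => i _.
  rewrite -mulNr -polyCN; congr (_%:P * _).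
  have [odd_i|even_i] := boolP (odd i); first by rewrite -signr_odd odd_i; ring.
  case: (i : nat) even_i => [_|k even_k].
    by rewrite subn0 subn1 (b_odd N.-1) ?mulr0 ?oppr0 //; lia.
  by rewrite (b_odd k.+2 even_k isT) mulr0 !mul0r oppr0.
have -> : N = 2%N by lia.
rewrite /mixed_sum /= expr0 alg_polyC.
under eq_bigr => j _ do rewrite big_ord1 /= !expr0 mul1r !mulr1.
under [in RHS]eq_bigr => j _ do rewrite big_ord1 /= !expr0 !mul1r !mulr1.
rewrite -!mulr_suml.
have -> : \sum_(j < n.+1) (-1) ^+ j = ((~~ odd n)%:R : R)%:P.
  elim: n => [|n IHn]; first by rewrite big_ord1.
  rewrite big_ord_recr /= IHn -signr_odd /=.
  by case: (odd n); rewrite /= ?expr0 ?expr1 ?polyC0 ?add0r ?subrr.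
rewrite -!polyCM -polyCD -polyCN mulr1 b1; congr (_%:P).
by case: (odd n) => /=; field.
Qed.

(** * Extraction of the coefficients *)

Lemma coef_linearX (K : comNzRingType) (c d : K) (m k : nat) :
  ((c%:P + d *: 'X) ^+ m)`_k = 'C(m, k)%:R * d ^+ k * c ^+ (m - k).
Proof.
rewrite exprDn coef_sum.
under eq_bigr => i _ do
  rewrite exprZn -polyC_exp mul_polyC scalerA coefMn coefZ coefXn.
have [lt_mk|le_km] := ltnP m k.
  rewrite bin_small // !mul0r big1 // => i _.
  by rewrite gtn_eqF ?mulr0 ?mul0rn // (leq_trans _ lt_mk).
rewrite (bigD1 (Ordinal (le_km : k < m.+1)%N)) //= eqxx mulr1.
rewrite big1 => [|i ne_ik].
  by rewrite addr0 -mulr_natl; ring.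
by rewrite [k == i]eq_sym (negPf (ne_ik : (i != k :> nat))) mulr0 mul0rn.
Qed.

Lemma bin_ffactV (R : numFieldType) (m k : nat) : (k <= m)%N ->
  'C(m, k)%:R = m`!%:R / (m - k)`!%:R / k`!%:R :> R.
Proof.
move=> le_km; rewrite -(bin_fact le_km) !natrM.
by have := @fact_neq0 R k; have := @fact_neq0 R (m - k) => *; field; apply/andP.
Qed.

Lemma coef_mixed_sum (R : numFieldType) (c : nat -> R) (D Q D' Q' : R)
    (N e : nat) :
    (e.+1 < N)%N ->
  (mixed_sum (fun i => (c i)%:P) N (D%:P + Q *: 'X) (D'%:P + Q' *: 'X))`_e =
  \sum_(al < e.+1) \sum_(be < e.+1 | (al + be == e)%N)
    (Q ^+ be * Q' ^+ al) / (al`!%:R * be`!%:R) *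
    \sum_(al <= i < (N - 2 - be).+1)
      c i * ((N - 2 - i)`!%:R / (N - 2 - i - be)`!%:R *
             (i`!%:R / (i - al)`!%:R)) *
      (D ^+ (N - 2 - i - be) * D' ^+ (i - al)).
Proof.
move=> lt_eN; rewrite coef_sum.
under eq_bigr => i _ do rewrite coefCM coefMr mulr_sumr.
rewrite exchange_big; apply: eq_bigr => al _ /=.
have le_al : (al <= e)%N by rewrite -ltnS.
have lt_be : (e - al < e.+1)%N by rewrite ltnS leq_subr.
rewrite (big_pred1 (Ordinal lt_be)) /=; last first.
  by move=> be /=; rewrite -val_eqE /= -(eqn_add2l al be (e - al)) subnKC.
set be := (e - al)%N.
pose G i := c i *
  ((N - 2 - i)`!%:R / (N - 2 - i - be)`!%:R * (i`!%:R / (i - al)`!%:R)) *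
  (D ^+ (N - 2 - i - be) * D' ^+ (i - al)).
(* Outside the range of the right-hand sum a binomial coefficient vanishes. *)
rewrite big_geq_mkord (@big_ord_widen_cond _ _ _ _ N.-1 (leq al) G);
  last by lia.
rewrite mulr_sumr [RHS]big_mkcond; apply: eq_bigr => i _ /=.
rewrite !coef_linearX.
case: ifP => [/andP[le_ali lt_i]|out].
  rewrite (bin_ffactV R le_ali) (@bin_ffactV R (N - 2 - i) be); last by lia.
  by rewrite /G invfM; ring.
have [lt_ial|le_ali] := ltnP i al; first by rewrite (bin_small lt_ial); ring.
rewrite (@bin_small (N - 2 - i)); first by ring.
by move: out (ltn_ord i) lt_be; rewrite le_ali -/be; lia.
Qed.

Section CoefficientExtraction.
Variables (R : numFieldType) (a : seq nat) (p q e f : nat).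
Hypotheses (e_gt0 : (0 < e)%N) (f_gt0 : (0 < f)%N).
Let N := (e + f)%N.
Let b m : R := bernoulli R m / m`!%:R.

Lemma coef_sum_f_term j :
  (mixed_sum (fun i => ((-1) ^+ i * b i.+1 * b (N - i - 1)%N)%:P) N
     (cvg_poly R a p q j) (cvg_poly R a p q j.+1))`_e.-1 =
  \sum_(al < e) \sum_(be < e | (al + be == e - 1)%N) f_term R a p q N j al be.
Proof.
rewrite /N; case: e e_gt0 => // e' _; rewrite coef_mixed_sum; last by lia.
rewrite subn1 /=; apply: eq_bigr => al _; apply: eq_bigr => be _.
congr (_ * _); apply: eq_big_nat => i /andP[le_i lt_i].
have -> : (e'.+1 + f - i - 1 = (e'.+1 + f - 2 - i).+1)%N by lia.
set m := (e'.+1 + f - 2 - i)%N; rewrite /b !factS !natrM.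
have := @fact_neq0 R i; have := @fact_neq0 R m.
have := @fact_neq0 R (i - al); have := @fact_neq0 R (m - be).
move: (i - al)`! (m - be)`! => F1 F2 F2_neq0 F1_neq0 m_neq0 i_neq0.
by field; rewrite F1_neq0 F2_neq0 m_neq0 i_neq0 !nat1r !pnatr_eq0.
Qed.

Lemma coef_sum_g_term k :
  (mixed_sum (fun _ => 1) N
     (cvg_poly R a p q k) (cvg_poly R a p q k.+2))`_e.-1 =
  \sum_(al < e) \sum_(be < e | (al + be == e - 1)%N) g_term R a p q N k al be.
Proof.
rewrite /N; case: e e_gt0 => // e' _.
rewrite (@coef_mixed_sum _ (fun _ => 1)); last by lia.
rewrite subn1 /=; apply: eq_bigr => al _; apply: eq_bigr => be _.
congr (_ * _); apply: eq_big_nat => i /andP[le_i lt_i].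
have -> : (e'.+1 + f - i - 2 = e'.+1 + f - 2 - i)%N by lia.
ring.
Qed.

(** s^I_(e,f) / (e! f!) is a coefficient of y^(e-1). *)
Lemma sI_coef :
  sI R a e f p q = e`!%:R * f`!%:R *
    (\sum_(j < (size a).+1) (-1) ^+ j *
       mixed_sum (fun i => ((-1) ^+ i * b i.+1 * b (N - i - 1)%N)%:P) N
         (cvg_poly R a p q j) (cvg_poly R a p q j.+1)
     + (b N)%:P * \sum_(k < size a) (-1) ^+ k * (nth 0%N a k)%:R *
       mixed_sum (fun _ => 1) N
         (cvg_poly R a p q k) (cvg_poly R a p q k.+2))`_e.-1.
Proof.
rewrite /sI -/N; congr (_ * _); rewrite coefD coefCM !coef_sum -/(b N).
rewrite (eq_bigr (fun al : 'I_e =>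
   \sum_(be < e | (al + be == e - 1)%N)
     \sum_(j < (size a).+1) (-1) ^+ j * f_term R a p q N j al be +
   b N * \sum_(be < e | (al + be == e - 1)%N)
     \sum_(k < size a)
        (-1) ^+ k * (nth 0%N a k)%:R * g_term R a p q N k al be)).
  rewrite big_split -mulr_sumr /=; congr (_ + _ * _).
    under eq_bigr => al _ do rewrite exchange_big.
    rewrite exchange_big; apply: eq_bigr => j _ /=.
    rewrite -polyC_sign coefCM coef_sum_f_term mulr_sumr.
    by apply: eq_bigr => al _; rewrite mulr_sumr.
  under eq_bigr => al _ do rewrite exchange_big.
  rewrite exchange_big; apply: eq_bigr => k _ /=.
  rewrite -polyC_sign -polyC_natr -polyCM coefCM coef_sum_g_term mulr_sumr.
  by apply: eq_bigr => al _; rewrite mulr_sumr.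
move=> al _; rewrite big_split /= mulr_sumr; congr (_ + _).
  by apply: eq_bigr => be _; rewrite big_mkord.
by apply: eq_bigr => be _; rewrite big_mkord.
Qed.

End CoefficientExtraction.

(** * Dedekind sums as sums of Bernoulli polynomials *)

Lemma periodic_bernoulli_ratio (R : archiRealFieldType) (m k q : nat) :
    (0 < q)%N ->
  periodic_bernoulli m (k%:R / q%:R : R) =
  if (m == 1%N) && (q %| k)%N then 0
  else (bernoulli_poly R m).[(k %% q)%:R / q%:R].
Proof.
move=> q_gt0; have q_neq0 : q%:R != 0 :> R by rewrite pnatr_eq0 -lt0n.
have qR_gt0 : 0 < q%:R :> R by rewrite ltr0n.
have kE : k%:R / q%:R = (k %/ q)%:R + (k %% q)%:R / q%:R :> R.
  by rewrite {1}(divn_eq k q) natrD natrM mulrDl mulfK.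
have floorE : Num.floor (k%:R / q%:R : R) = (k %/ q)%:Z.
  apply: floor_def; rewrite kE -pmulrn lerDl divr_ge0 ?ler0n //=.
  by rewrite intrD -pmulrn ltrD2l ltr_pdivrMr // mul1r ltr_nat ltn_mod.
rewrite /periodic_bernoulli floorE -pmulrn; congr (if _ && _ then _ else _.[_]).
  rewrite intrEfloor floorE -pmulrn kE -subr_eq0 opprD addNKr oppr_eq0.
  by rewrite mulf_eq0 invr_eq0 (negPf q_neq0) orbF pnatr_eq0.
by rewrite kE addrC addKr.
Qed.

Lemma bernoulli_poly0 (R : numFieldType) (m : nat) :
  (bernoulli_poly R m).[0] = bernoulli R m.
Proof.
rewrite horner_sum big_ord_recl big1 => [|i _].
  by rewrite hornerZ hornerXn expr0 bin0 subn0 mulr1 mul1r addr0.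
by rewrite hornerZ hornerXn expr0n mulr0.
Qed.

(** If e = 1 or f = 1, the summand of the Dedekind sum at k = 0 vanishes, and
    the correction by delta replaces it with B_e B_f.  For 0 < k < q neither
    argument is an integer, as p and q are coprime. *)
Lemma dedekind_sumE (R : archiRealFieldType) (e f p q : nat) :
    coprime p q -> (0 < q)%N ->
  dedekind_sum R e f p q + (delta1 e f)%:R * bernoulli R e * bernoulli R f =
  \sum_(k < q) (bernoulli_poly R e).[k%:R / q%:R] *
               (bernoulli_poly R f).[((p * k) %% q)%:R / q%:R].
Proof.
move=> cpq q_gt0; rewrite /dedekind_sum big_mkord.
under eq_bigr => k _ do
  rewrite !periodic_bernoulli_ratio // Gauss_dvdr 1?coprime_sym //.
case: q q_gt0 cpq => // q _ cpq.
rewrite !big_ord_recl /= dvdn0 muln0 mod0n mul0r !bernoulli_poly0.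
rewrite addrAC !andbT; congr (_ + _).
  rewrite /delta1; case: eqP => _; case: eqP => _ /=;
    by rewrite ?mul0r ?mulr0 ?add0r ?addr0 ?mul1r.
apply: eq_bigr => k _; rewrite /bump /= add1n.
have -> : (q.+1 %| k.+1)%N = false by rewrite gtnNdvd // ltnS.
by rewrite !andbF modn_small // ltnS.
Qed.

(** * The formula *)

Unset Implicit Arguments.

Theorem theorem1p1 (R : archiRealFieldType) (p q : nat) (a : seq nat)
    (e f : nat)
    (hpq : coprime p q) (hp : (0 < p)%N) (hlt : (p < q)%N)
    (ha : all (fun x => (1 <= x)%N) a)
    (hcf : q%:R / p%:R = cfrac R a)
    (he : (0 < e)%N) (hf : (0 < f)%N) (hN : ~~ odd (e + f)) :
  dedekind_sum R e f p q + (delta1 e f)%:R * bernoulli R e * bernoulli R f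
  = (q%:R ^+ (e + f - 2))^-1 * sI R a e f p q
    + (q%:R ^+ (e + f - 1))^-1 * sR R a e f p.
Proof.
have q_gt0 : (0 < q)%N := leq_ltn_trans (leq0n p) hlt.
have q_neq0 : q%:R != 0 :> R by rewrite pnatr_eq0 -lt0n.
have [a_neq0 Epair] := cf_pair_unique hpq hp q_gt0 ha hcf.
have N_gt1 : (1 < e + f)%N by lia.
have := cf_identity_poly R ha N_gt1; rewrite Epair /=.
set N := (e + f)%N in N_gt1 *; set n := size a.
set A := cvg_poly R a p q; pose b m : R := bernoulli R m / m`!%:R.
rewrite -/(b N) -/(b N.-1).
have := sum_sign_mixed_parity n q A N_gt1 hN; rewrite /= -/(b N.-1).
have EsI := sI_coef R a p q he hf; rewrite -/N -/(b N) -/A -/n in EsI.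
set P := \sum_(j < n.+1) _; set Pm := \sum_(j < n.+1) _ in EsI *.
set G := \sum_(k < n) _ in EsI *; set c := (_ * b N.-1 * _) => Epar.
have -> : 'X^(N.-1) = 'X * 'X^(N - 2) :> {poly R}.
  by rewrite -exprS; congr ('X^_); lia.
(* Insert the signs (-1)^i of the f_k; this absorbs the last summand. *)
have -> : 'X * (P - (b N)%:P * G) +
    (b N / q%:R) *: ((-1) ^+ n * A n ^+ N.-1 - 'X * A 1%N ^+ N.-1) +
    c *: ('X * 'X^(N - 2)) =
    - ('X * (Pm + (b N)%:P * G)) +
    (b N / q%:R) *: ((-1) ^+ n * A n ^+ N.-1 - 'X * A 1%N ^+ N.-1).
  rewrite -!mul_polyC; rewrite -mul_polyC in Epar.
  by rewrite -[Pm]opprK -Epar; ring.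
move=> /(congr1 (fun Z : {poly R} => Z`_e)).
have e_neq0 : (e == 0)%N = false by rewrite gtn_eqF.
have le_eN : (e < N.+1)%N by rewrite ltnS leq_addr.
have sum_e : (\sum_(k < q) \sum_(i < N.+1)
    (q%:R ^+ (N - 2) * ((bernoulli_poly R i).[k%:R / q%:R] / i`!%:R) *
      ((bernoulli_poly R (N - i)).[((p * k) %% q)%:R / q%:R] / (N - i)`!%:R))
      *: 'X^i : {poly R})`_e =
  q%:R ^+ (N - 2) / (e`!%:R * f`!%:R) *
    (dedekind_sum R e f p q + (delta1 e f)%:R * bernoulli R e * bernoulli R f).
  rewrite dedekind_sumE // mulr_sumr coef_sum; apply: eq_bigr => k _.
  rewrite coef_sum (bigD1 (Ordinal le_eN)) //= big1 => [|i ne_ie].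
    rewrite addr0 coefZ coefXn eqxx mulr1 /N addKn invfM; ring.
  by rewrite coefZ coefXn eq_sym (negPf (ne_ie : (i != e :> nat))) mulr0.
rewrite coefN {}sum_e coefD coefN coefXM e_neq0 coefZ coefB coefXM e_neq0.
(* The poles at both ends, 1 / A_(-1) and 1 / A_n, give s^R. *)
have coef_A1 : (A 1%N ^+ N.-1)`_e.-1 = 'C(N - 1, f)%:R * p%:R ^+ f.
  rewrite /A /cvg_poly coef_linearX /cvg_D !mulr1 mulr0 subr0 expr1n mulr1.
  have -> : (N.-1 - e.-1 = f)%N by lia.
  have le_fN : (f <= N.-1)%N by lia.
  rewrite subn1 -(bin_sub le_fN); have -> : (N.-1 - f = e.-1)%N by lia.
  by [].
have coef_An : ((-1) ^+ n * A n ^+ N.-1)`_e =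
    - ((-1) ^+ (e * (n - 1)) * 'C(N - 1, e)%:R * (cvg_q a n)%:R ^+ e).
  rewrite -polyC_sign coefCM /A /cvg_poly coef_linearX.
  have -> : cvg_D R a p q n = - (-1) ^+ n.
    rewrite -(convergent_det R a n) cvg_q_last cvg_p_last Epair /= /cvg_D.
    by ring.
  have -> : (N.-1 - e = f.-1)%N by lia.
  rewrite -subn1.
  (* D_(n-1) = (-1)^(n-1), and e and f have the same parity. *)
  have -> : (-1) ^+ (e * (n - 1)) = - ((-1) ^+ n * (- (-1) ^+ n) ^+ f.-1) :> R.
    have n_gt0 : (0 < n)%N by rewrite lt0n size_eq0.
    rewrite -mulNr -exprS prednK //.
    have odd_ef : odd e = odd f by move: hN; rewrite oddD negb_add => /eqP.
    rewrite -(prednK n_gt0) exprS mulN1r opprK subn1 /= -exprM.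
    by rewrite -signr_odd -[RHS]signr_odd !oddM odd_ef andbC.
  ring.
rewrite coef_A1 coef_An EsI /sR -/N -/n -/(b N).
have -> : q%:R ^+ (N - 1) = q%:R * q%:R ^+ (N - 2) :> R.
  by rewrite -exprS; congr (_ ^+ _); lia.
have ef_neq0 : e`!%:R * f`!%:R != 0 :> R by rewrite mulf_neq0 ?fact_neq0.
have qN_neq0 : q%:R ^+ (N - 2) != 0 :> R by rewrite expf_neq0.
move: ef_neq0 qN_neq0; move: (e`!%:R * f`!%:R) (q%:R ^+ (N - 2)) => ef qN.
move=> ef_neq0 qN_neq0; set S := dedekind_sum _ _ _ _ _ + _ => Ecoef.
have -> : S = - (ef / qN) * - (qN / ef * S) by field; rewrite ef_neq0.
by rewrite Ecoef; field; rewrite qN_neq0 q_neq0.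
Qed.
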